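(* Let $X$ be a normal space. Denote by $\mathscr{B}(X)$ the set of all closed open bornologies in $X$ (that is, bornologies in $X$ that are both closed and open) and denote by $\mathscr{H}(X)$ the set of all non-vanishing closed ideals in $C_B(X)$, both partially ordered by $\subseteq$. Then $\mathscr{B}(X)$ and $\mathscr{H}(X)$ are order-isomorphic.
   Context: Normal spaces are Hausdorff. $C_B(X)$ is the normed algebra of continuous bounded $f:X\to\mathbb{C}$ with the supremum norm. An ideal $H$ of $C_B(X)$ is non-vanishing if for every $x\in X$ there is $h\in H$ with $h(x)\neq0$. A bornology in a set $X$ is a non-empty collection $\mathfrak{B}$ of subsets of $X$, closed under taking subsets and finite unions, with $X=\bigcup\mathfrak{B}$. A bornology $\mathfrak{B}$ in a space $X$ is closed (respectively, open) if each element of $\mathfrak{B}$ is contained in an element of $\mathfrak{B}$ that is closed (respectively, open) in $X$. Two partially ordered sets are order-isomorphic if there is a bijection $f$ between them such that $f(x)\leq f(y)$ if and only if $x\leq y$. *)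

(* Defs.v *)
From HB Require Import structures.
From mathcomp Require Import all_boot all_order all_algebra.
From mathcomp Require Import complex.
From mathcomp Require Import all_classical all_reals.
From mathcomp Require Import topology normedtype measurable_structure.

Set Implicit Arguments.
Unset Strict Implicit.
Unset Printing Implicit Defensive.

Import Order.TTheory GRing.Theory Num.Theory.
Import numFieldNormedType.Exports.

Local Open Scope classical_set_scope.
Local Open Scope complex_scope.
Local Open Scope ring_scope.

(* The library attaches the norm topology to the sort of an abstract
   numFieldType and to regular algebras, but not to the type constructor
   R[i]; this is the same topology, keyed on R[i]. *)
HB.instance Definition _ (R : rcfType) := NormedModule.copy R[i] R[i]^o.

Section bounded_continuous.
Context (R : realType) (X : topologicalType).

Definition bcts : {pred (X -> R[i])} :=
  [pred f | `[< continuous f /\ bounded_fun f >]].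

Lemma bctsP (f : X -> R[i]) :
  reflect (continuous f /\ bounded_fun f) (f \in bcts).
Proof. exact: asboolP. Qed.

Record CB := MkCB { CB_fun :> X -> R[i]; CB_funP : CB_fun \in bcts }.

HB.instance Definition _ := [isSub for CB_fun].
HB.instance Definition _ := [Choice of CB by <:].

Lemma normc_normE (z : R[i]) : `|z| = (Normc.normc z)%:C.
Proof. by case: z. Qed.

Lemma normc_ge0 (z : R[i]) : 0 <= Normc.normc z.
Proof. by case: z => a b; exact: sqrtr_ge0. Qed.

Lemma bounded_normcP (f : X -> R[i]) :
  bounded_fun f <-> exists M : R, forall x, Normc.normc (f x) <= M.
Proof.
split=> [[M [Mreal fM]]|[M fM]].
  have M1 : M < M + 1 by rewrite ltrDl.
  exists (complex.Re (M + 1)) => x; have := fM _ M1 x I.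
  by rewrite /= normc_normE; case: (M + 1) => a b; rewrite lecE /= => /andP[].
exists M%:C; split; first by rewrite complex_real.
move=> [a b]; rewrite ltcE /= => /andP[/eqP b0 Ma] x _ /=.
by rewrite normc_normE lecE /= b0 eqxx /= (le_trans (fM x)) // ltW.
Qed.

Lemma bcts_subring_closed : subring_closed bcts.
Proof.
split.
- apply/bctsP; split; first exact: cst_continuous.
  by apply/bounded_normcP; exists (Normc.normc (1 : R[i])).
- move=> f g /bctsP[cf /bounded_normcP[M fM]] /bctsP[cg /bounded_normcP[N gN]].
  apply/bctsP; split; first by move=> x; apply: cvgB; [exact: cf|exact: cg].
  apply/bounded_normcP; exists (M + N) => x.
  apply: le_trans (le_normcD _ _) _.
  by rewrite normcN lerD.
- move=> f g /bctsP[cf /bounded_normcP[M fM]] /bctsP[cg /bounded_normcP[N gN]].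
  apply/bctsP; split; first by move=> x; apply: cvgM; [exact: cf|exact: cg].
  apply/bounded_normcP; exists (M * N) => x.
  by rewrite Normc.normcM ler_pM ?normc_ge0.
Qed.

Lemma bcts_scaler_closed : GRing.scaler_closed bcts.
Proof.
move=> a f /bctsP[cf /bounded_normcP[M fM]]; apply/bctsP; split.
  by move=> x; apply: cvgM; [exact: cvg_cst|exact: cf].
apply/bounded_normcP; exists (Normc.normc a * M) => x.
by rewrite Normc.normcM ler_wpM2l ?normc_ge0.
Qed.

HB.instance Definition _ := GRing.isSubringClosed.Build (X -> R[i]) bcts
  bcts_subring_closed.
HB.instance Definition _ := GRing.isScaleClosed.Build R[i] (X -> R[i]) bcts
  bcts_scaler_closed.
HB.instance Definition _ :=
  GRing.SubChoice_isSubComPzRing.Build _ _ CB (subringClosedP _).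
HB.instance Definition _ := [SubZmodule_isSubLmodule of CB by <:].

(* Norms of modules over R[i] take their values in R[i], so the real supremum
   is embedded there; for empty X it is sup set0 = 0, the norm of the unique
   function. *)
Definition CB_norm (f : CB) : R[i] :=
  (sup (range (fun x => Normc.normc (f x))))%:C.

Lemma CB_bounded (f : CB) : exists M : R, forall x, Normc.normc (f x) <= M.
Proof. by apply/bounded_normcP; have /bctsP[] := CB_funP f. Qed.

Lemma CB_sup_ub (f : CB) x :
  Normc.normc (f x) <= sup (range (fun x => Normc.normc (f x))).
Proof.
have [M fM] := CB_bounded f.
by apply: ub_le_sup; [exists M => _ [y _ <-]|exists x].
Qed.

Lemma CB_sup_le (f : CB) (M : R) : 0 <= M ->
  (forall x, Normc.normc (f x) <= M) ->
  sup (range (fun x => Normc.normc (f x))) <= M.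
Proof.
move=> M0 fM; have [->|/set0P ne] :=
    eqVneq (range (fun x => Normc.normc (f x))) set0; first by rewrite sup0.
by apply: ge_sup => // _ [x _ <-].
Qed.

Lemma CB_sup_ge0 (f : CB) : 0 <= sup (range (fun x => Normc.normc (f x))).
Proof.
have [->|/set0P[_ [x _ _]]] :=
    eqVneq (range (fun x => Normc.normc (f x))) set0; first by rewrite sup0.
exact: le_trans (normc_ge0 _) (CB_sup_ub f x).
Qed.

Lemma ler_CB_normD (f g : CB) : CB_norm (f + g) <= CB_norm f + CB_norm g.
Proof.
rewrite -rmorphD lecR; apply: CB_sup_le => [|x].
  by rewrite addr_ge0// CB_sup_ge0.
by apply: le_trans (le_normcD _ _) _; rewrite lerD// CB_sup_ub.
Qed.

Lemma CB_normZ (a : R[i]) (f : CB) : CB_norm (a *: f) = `|a| * CB_norm f.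
Proof.
have le_Z b (g : CB) : sup (range (fun x => Normc.normc ((b *: g) x))) <=
    Normc.normc b * sup (range (fun x => Normc.normc (g x))).
  apply: CB_sup_le => [|x]; first by rewrite mulr_ge0 ?normc_ge0 ?CB_sup_ge0.
  by rewrite Normc.normcM ler_wpM2l ?normc_ge0 ?CB_sup_ub.
rewrite normc_normE -rmorphM; congr (_%:C); apply/eqP.
rewrite eq_le le_Z andTb.
have [->|a0] := eqVneq a 0.
  by rewrite Normc.normc0 mul0r; exact: CB_sup_ge0.
have na0 : 0 < Normc.normc a.
  rewrite lt_neqAle normc_ge0 andbT eq_sym.
  by apply: contra_neq a0; exact: Normc.eq0_normc.
by rewrite -ler_pdivlMl// -Normc.normcV -{1}(scalerK a0 f); exact: le_Z.
Qed.

Lemma CB_norm0_eq0 (f : CB) : CB_norm f = 0 -> f = 0.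
Proof.
case=> f0; apply/val_inj/funext => x; apply: Normc.eq0_normc.
by apply/eqP; rewrite eq_le normc_ge0 andbT -f0; exact: CB_sup_ub.
Qed.

HB.instance Definition _ := Lmodule_isNormed.Build R[i] CB
  ler_CB_normD CB_normZ CB_norm0_eq0.

Definition ideal (H : set CB) : Prop :=
  [/\ H 0, forall f g, H f -> H g -> H (f + g) &
      forall f g, H g -> H (f * g)].

Definition nonvanishing (H : set CB) : Prop :=
  forall x : X, exists2 h, H h & h x != 0.

Definition nonvanishing_closed_ideals : set (set CB) :=
  [set H | [/\ ideal H, nonvanishing H & closed H]].

End bounded_continuous.

Arguments CB : clear implicits.
Arguments nonvanishing_closed_ideals : clear implicits.

Definition bornology (T : Type) (B : set (set T)) : Prop :=
  [/\ B !=set0,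
      forall A C, B A -> C `<=` A -> B C,
      fin_bigcup_closed B &
      \bigcup_(A in B) A = setT].

Section topological_bornologies.
Context (X : topologicalType).

Definition closed_bornology (B : set (set X)) : Prop :=
  bornology B /\ forall A, B A -> exists C, [/\ A `<=` C, B C & closed C].

Definition open_bornology (B : set (set X)) : Prop :=
  bornology B /\ forall A, B A -> exists U, [/\ A `<=` U, B U & open U].

Definition closed_open_bornologies : set (set (set X)) :=
  [set B | closed_bornology B /\ open_bornology B].

End topological_bornologies.

Arguments closed_open_bornologies : clear implicits.

Definition order_isomorphic_incl (S T : Type)
    (P : set (set S)) (Q : set (set T)) : Prop :=
  exists f : set S -> set T,
    set_bij P Q f /\
    forall A B, P A -> P B -> (f A `<=` f B <-> A `<=` B).

(* Main.v *)
(** To a bornology B corresponds the ideal of those f with {|f| >= e} in B for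
    all e > 0, and to an ideal H the bornology generated by the sets {|h| >= 1}
    with h in H.  Urysohn's lemma applied to C <= U, where C is closed, U is
    open and both are in B, recovers B from its ideal.  Conversely, if
    {|f| >= e} is contained in {|h| >= 1} with h in H, then for large n the
    function f n|h|^2 / (1 + n|h|^2), which lies in H, is within e of f; so f
    is in the closure of H. *)
Require Import Defs.
From mathcomp Require Import all_boot all_order all_algebra.
From mathcomp Require Import complex.
From mathcomp Require Import all_classical all_reals topology.
From mathcomp Require Import normedtype measurable_structure lra.

Set Implicit Arguments.
Unset Strict Implicit.
Unset Printing Implicit Defensive.

Import Order.TTheory GRing.Theory Num.Theory.
Import numFieldNormedType.Exports.

Local Open Scope classical_set_scope.
Local Open Scope complex_scope.
Local Open Scope ring_scope.

Local Notation normc := Normc.normc.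

(** * Continuity of the modulus, of conjugation and of the real embedding *)

Section complex_continuity.
Context (R : realType).
Implicit Types z w : R[i].

Lemma normc_real (a : R) : normc a%:C = `|a|.
Proof. by rewrite /= expr0n addr0 sqrtr_sqr. Qed.

Lemma mulc_conj z : z * z^*%C = (normc z ^+ 2)%:C.
Proof. by rewrite -sqr_normc normc_normE rmorphXn. Qed.

Lemma normcB_le z w : normc z - normc w <= normc (z - w).
Proof.
by rewrite lerBlDr; apply: le_trans (le_normcD _ _); rewrite subrK.
Qed.

Lemma normc_dist z w : `|normc z - normc w| <= normc (z - w).
Proof.
rewrite ler_norml normcB_le andbT lerNl opprB.
by rewrite -(normcN (z - w)) opprB normcB_le.
Qed.

Lemma real_complex_continuous : continuous (fun a : R => a%:C).
Proof.
move=> a; apply/cvgrPdist_lt => e; case: e => e i; rewrite ltcE /=.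
(* A positive element of [R[i]] has imaginary part 0, so real radii suffice. *)
move=> /andP[/eqP -> e0].
near=> b; rewrite -rmorphB /= normc_normE normc_real ltcR.
by near: b; apply: cvgr_dist_lt e0; exact: cvg_id.
Unshelve. all: by end_near.
Qed.

Lemma conjc_continuous : continuous (fun z : R[i] => z^*%C).
Proof.
move=> z; apply/(@cvgrPdist_lt _ R[i] _ (nbhs z)) => e e0.
by apply/nbhs_normP; exists e => // w; rewrite /= -rmorphB /= normcJ.
Qed.

Lemma normc_continuous : continuous (@Normc.normc R).
Proof.
move=> z; apply/(@cvgrPdist_lt _ R _ (nbhs z)) => e e0.
apply/nbhs_normP; exists e%:C; first by rewrite /= ltcR.
by move=> w; rewrite /= normc_normE ltcR; exact: le_lt_trans (normc_dist _ _).
Qed.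

End complex_continuity.

(** * Elements of C_B(X) with prescribed values, and uniform closure *)

Section superlevel_sets.
Context (R : realType) (X : topologicalType).
Implicit Types (f g h : CB R X) (H : set (CB R X)) (B : set (set X)).

Definition superlevel f (e : R) : set X := [set x | e <= normc (f x)].

Lemma CB_continuous f : continuous f.
Proof. by have /bctsP[] := CB_funP f. Qed.

Lemma CB_normc_continuous f : continuous (fun x => normc (f x)).
Proof.
move=> x; apply: (@continuous_comp _ _ _ f (@Normc.normc R)).
  exact: CB_continuous.
exact: normc_continuous.
Qed.

Lemma CB_real_ex (u : X -> R) (M : R) :
  continuous u -> (forall x, `|u x| <= M) -> exists f, forall x, f x = (u x)%:C.
Proof.
move=> uc uM; have uP : (fun x => (u x)%:C) \in @bcts R X.
  apply/bctsP; split.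
    move=> x; apply: (@continuous_comp _ _ _ u (fun a => a%:C)).
      exact: uc.
    exact: real_complex_continuous.
  by apply/bounded_normcP; exists M => x; rewrite normc_real.
by exists (MkCB uP).
Qed.

Lemma CB_conj_ex f : exists g, forall x, g x = (f x)^*%C.
Proof.
have cP : (fun x => (f x)^*%C) \in @bcts R X.
  apply/bctsP; split.
    move=> x; apply: (@continuous_comp _ _ _ f (fun z => z^*%C)).
      exact: CB_continuous.
    exact: conjc_continuous.
  have [M fM] := CB_bounded f; apply/bounded_normcP; exists M => x.
  by case: (f x) (fM x) => a b /=; rewrite sqrrN.
by exists (MkCB cP).
Qed.

Lemma CB_cst_ex (c : R) : exists f, forall x, f x = c%:C.
Proof. by apply: (@CB_real_ex _ `|c|) => // x; exact: cvg_cst. Qed.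

Lemma closed_superlevel f e : closed (superlevel f e).
Proof.
apply: (@closed_comp _ _ (fun x => normc (f x)) [set a | e <= a]).
  by move=> x _; exact: CB_normc_continuous.
exact: closed_ge.
Qed.

Lemma CB_dist_lt f g x (e : R) :
  `|f - g| < e%:C -> normc (f x - g x) < e.
Proof.
by rewrite ltcR; apply: le_lt_trans; exact: (CB_sup_ub (f - g) x).
Qed.

Lemma CB_dist_le f g (e : R) : 0 <= e ->
  (forall x, normc (f x - g x) <= e) -> `|f - g| <= e%:C.
Proof. by move=> e0 fge; rewrite lecR; exact: CB_sup_le. Qed.

Lemma closure_CBP H f :
  closure H f <->
  forall e : R, 0 < e -> exists2 g, H g & forall x, normc (f x - g x) <= e.
Proof.
split=> [Hf e e0|Hf A /(@nbhs_normP _ (CB R X) f A)[[e i]]].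
  have [|g [Hg fg]] := Hf [set g | `|f - g| < e%:C].
    by apply/(@nbhs_normP _ (CB R X)); exists e%:C; rewrite //= ltcR.
  by exists g => // x; apply/ltW/CB_dist_lt.
rewrite /= ltcE /= => /andP[/eqP -> e0] fA.
(* Pointwise bounds pass to the supremum norm only as a non-strict bound; halving [e] leaves room
   for the open ball. *)
have [|g Hg fg] := Hf (e / 2); first by rewrite divr_gt0.
exists g; split=> //; apply: fA => /=.
apply: (@le_lt_trans _ _ (e / 2)%:C); last by rewrite ltcR; lra.
by apply: CB_dist_le => //; lra.
Qed.

End superlevel_sets.

(** * The two correspondences, and approximation within an ideal *)

Section ideals_and_bornologies.
Context (R : realType) (X : topologicalType).
Implicit Types (f g h : CB R X) (H : set (CB R X)) (B : set (set X)).

Definition ideal_of_bornology B : set (CB R X) :=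
  [set f | forall e : R, 0 < e -> B (superlevel f e)].

(** For an ideal, the level 1 is no restriction because of scaling, and finite unions need not be
    added because |h|^2 + |g|^2 absorbs them. *)
Definition bornology_of_ideal H : set (set X) :=
  [set A | exists2 h, H h & A `<=` superlevel h 1].

Lemma ideal_scale H h (c : R) : ideal H -> H h ->
  exists2 g, H g & forall x, g x = c%:C * h x.
Proof.
move=> [_ _ HM] Hh; have [k kE] := CB_cst_ex X c.
by exists (k * h); [exact: HM|move=> x; rewrite -(kE x)].
Qed.

(** The conjugate of [h] need only lie in C_B(X), not in [H], for its product with [h] to lie in
    [H]. *)
Lemma ideal_sqr_normc H h : ideal H -> H h ->
  exists2 g, H g & forall x, g x = (normc (h x) ^+ 2)%:C.
Proof.
move=> [_ _ HM] Hh; have [k kE] := CB_conj_ex h.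
by exists (k * h); [exact: HM|move=> x; rewrite -mulc_conj mulrC -(kE x)].
Qed.

Lemma ideal_approx H f h (e : R) : ideal H -> H h -> 0 < e ->
  superlevel f e `<=` superlevel h 1 ->
  exists2 g, H g & forall x, normc (f x - g x) <= e.
Proof.
move=> HI Hh e0 fh; have [M fM] := CB_bounded f.
(* This [c] is the n of the overview, chosen so that [e * c] is [|M|]. The absolute value is there
   because [M] may be negative when X is empty. *)
pose c := `|M| / e; have c0 : 0 <= c by rewrite divr_ge0// ltW.
pose d x := 1 + c * normc (h x) ^+ 2.
have d1 x : 1 <= d x by rewrite lerDl mulr_ge0// sqr_ge0.
have d0 x : 0 < d x by exact: lt_le_trans (d1 x).
have dcts : continuous d.
  move=> x; apply: cvgD; first exact: cvg_cst.
  apply: cvgM; first exact: cvg_cst.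
  by apply: cvgM; exact: CB_normc_continuous.
have [u uE] : exists u : CB R X, forall x, u x = (c / d x)%:C.
  apply: (@CB_real_ex _ _ _ c) => x.
    apply: cvgM; first exact: cvg_cst.
    by apply: cvgV; [rewrite gt_eqF|exact: dcts].
  rewrite ger0_norm; last by rewrite divr_ge0// ltW.
  by rewrite ler_pdivrMr// ler_peMr.
have [k Hk kE] := ideal_sqr_normc HI Hh.
exists (f * (u * k)); first by have [_ _ HM] := HI; exact/HM/HM.
(* The error is f / d, since 1 - c|h|^2 / d = 1 / d. *)
move=> x; have -> : f x - (f * (u * k)) x = f x * ((d x)^-1)%:C.
  have -> : (f * (u * k)) x = f x * (u x * k x) by [].
  rewrite uE kE -rmorphM -[X in X - _]mulr1 -mulrBr -(rmorphB _ 1).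
  congr (_ * _%:C).
  apply: (mulIf (lt0r_neq0 (d0 x))).
  rewrite mulrBl mulVf ?gt_eqF// mul1r mulrAC divfK ?gt_eqF//.
  by rewrite /d addrK.
rewrite Normc.normcM normc_real ger0_norm ?invr_ge0 ?(ltW (d0 x))//.
(* Where |f| < e, the bound follows from d >= 1. Elsewhere |h| >= 1, so d >= c and |f| <= |M| = e c
   <= e d. *)
rewrite ler_pdivrMr//; have [fe|ef] := ltP (normc (f x)) e.
  by apply: (le_trans (ltW fe)); rewrite ler_peMr// ltW.
have h1 : 1 <= normc (h x) by exact: fh.
apply: (le_trans (fM x)); apply: (le_trans (ler_norm M)).
have -> : `|M| = e * c by rewrite /c mulrC divfK ?gt_eqF.
rewrite ler_wpM2l ?ltW// /d.
have : c <= c * normc (h x) ^+ 2 by rewrite ler_peMr// exprn_ege1.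
lra.
Qed.

(** * From bornologies to ideals *)

Lemma bornologyU B (A C : set X) : bornology B -> B A -> B C -> B (A `|` C).
Proof. by case=> _ _ /fin_bigcup_closedP[_ +] _ => /[apply]; apply. Qed.

Lemma bornology0 B : bornology B -> B set0.
Proof. by case=> _ _ /fin_bigcup_closedP[]. Qed.

(** If |f + g| >= e then |f| or |g| is at least e/2; if |f g| >= e and |f| <= M then |g| >= e / (|M|
    + 1), the 1 keeping the divisor positive. *)
Lemma ideal_ideal_of_bornology B : bornology B -> ideal (ideal_of_bornology B).
Proof.
move=> Bb; have [_ BS _ _] := Bb; split.
- move=> e e0; apply: BS (bornology0 Bb) _ => x.
  rewrite (_ : superlevel 0 e x = (e <= normc (0 : R[i])))//.
  by rewrite Normc.normc0 leNgt e0.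
- move=> f g Bf Bg e e0; have e2 : 0 < e / 2 by rewrite divr_gt0.
  apply: BS (bornologyU Bb (Bf _ e2) (Bg _ e2)) _ => x /= efg.
  have := le_trans efg (le_normcD (f x) (g x)) => fge.
  have [|fx] := leP (e / 2) (normc (f x)); first by left.
  by right; rewrite /superlevel /mkset; lra.
- move=> f g Bg e e0; have [M fM] := CB_bounded f.
  have M0 : 0 < `|M| + 1 by rewrite ltr_wpDl.
  apply: BS (Bg (e / (`|M| + 1)) _) _; first by rewrite divr_gt0.
  move=> x; rewrite /superlevel /mkset => efg.
  rewrite ler_pdivrMr//; apply: le_trans efg _.
  rewrite Normc.normcM mulrC ler_wpM2l ?normc_ge0//.
  by apply: le_trans (fM x) _; apply: le_trans (ler_norm M) _; rewrite lerDl.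
Qed.

(** If g is within e/2 of f, then |f| >= e forces |g| >= e/2. *)
Lemma closed_ideal_of_bornology B :
  bornology B -> closed (ideal_of_bornology B).
Proof.
move=> [_ BS _ _] f /closure_CBP fcl e e0.
have [|g Bg fg] := fcl (e / 2); first by rewrite divr_gt0.
apply: BS (Bg (e / 2) _) _; first by rewrite divr_gt0.
move=> x; rewrite /superlevel /mkset => ef.
by have := normcB_le (f x) (g x); have := fg x; lra.
Qed.

(** A Urysohn function that is 0 off [U] and 1 on [C] has all its positive superlevel sets inside
    [U]. *)
Lemma normal_separation (C U : set X) : normal_space X ->
  closed C -> open U -> C `<=` U ->
  exists f, C `<=` superlevel f 1 /\
    forall e : R, 0 < e -> superlevel f e `<=` U.
Proof.
move=> Xn cC oU CU.
have /(@uniform_separatorP _ R)[u [uc u01 u0 u1]] : uniform_separator (~` U) C.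
  apply: normal_uniform_separator => //; first exact: open_closedC.
  by apply/seteqP; split=> // x [nUx /CU].
have u_norm x : `|u x| <= 1.
  have /= := u01 (u x) (imageT u x).
  by rewrite in_itv /= ler_norml => /andP[]; lra.
have [f fE] := CB_real_ex uc u_norm.
exists f; split=> [x Cx|e e0 x]; rewrite /superlevel /mkset fE normc_real.
  by rewrite (u1 (u x)) ?normr1//; exists x.
by apply: contraPP => nUx; rewrite (u0 (u x)) ?normr0 ?leNgt ?e0//; exists x.
Qed.

(** Closedness of the bornology enlarges [A] to a closed [C], openness enlarges [C] to an open [U].
    As [U] is still in [B], the separating function lies in the ideal. *)
Lemma closed_open_bornology_level B (A : set X) : normal_space X ->
  closed_open_bornologies X B -> B A ->
  exists2 f, ideal_of_bornology B f & A `<=` superlevel f 1.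
Proof.
move=> Xn [[Bb Bc] [_ Bo]] /Bc[C [AC BC cC]].
have [U [CU BU oU]] := Bo _ BC; have [_ BS _ _] := Bb.
have [f [Cf fU]] := normal_separation Xn cC oU CU.
exists f; first by move=> e e0; exact: BS BU (fU e e0).
exact: subset_trans Cf.
Qed.

Lemma ideal_of_bornology_nonvanishing B : normal_space X ->
  closed_open_bornologies X B -> nonvanishing (ideal_of_bornology B).
Proof.
move=> Xn BB x; have [[[_ _ _ Bcov] _] _] := BB.
have [A BA Ax] : (\bigcup_(A in B) A) x by rewrite Bcov.
have [f Bf Af] := closed_open_bornology_level Xn BB BA.
exists f => //; apply/eqP => fx0; have := Af x Ax.
by rewrite /superlevel /mkset fx0 Normc.normc0 ler10.
Qed.

(** * From ideals to bornologies *)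

Lemma bornology_bornology_of_ideal H : ideal H -> nonvanishing H ->
  bornology (bornology_of_ideal H).
Proof.
move=> HI Hnv; have [H0 HD _] := HI; split.
- by exists set0, 0.
- by move=> A C [h Hh Ah] CA; exists h => //; exact: subset_trans Ah.
- apply/fin_bigcup_closedP; split; first by exists 0.
  move=> A C [h Hh Ah] [g Hg Cg].
  (* Squared moduli cannot cancel: their sum is at least 1 wherever one of |h|, |g| is. *)
  have [h2 Hh2 h2E] := ideal_sqr_normc HI Hh.
  have [g2 Hg2 g2E] := ideal_sqr_normc HI Hg.
  exists (h2 + g2); first exact: HD.
  move=> x hgx.
  rewrite (_ : superlevel (h2 + g2) 1 x = (1 <= normc (h2 x + g2 x)))//.
  rewrite h2E g2E -rmorphD normc_real ger0_norm ?addr_ge0 ?sqr_ge0//.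
  case: hgx => [/Ah|/Cg] /= x1.
    by rewrite ler_wpDr ?sqr_ge0// exprn_ege1.
  by rewrite ler_wpDl ?sqr_ge0// exprn_ege1.
- apply/seteqP; split=> // x _; have [h Hh hx] := Hnv x.
  have n0 : normc (h x) != 0 by apply: contra_neq hx; exact: Normc.eq0_normc.
  have [g Hg gE] := ideal_scale (normc (h x))^-1 HI Hh.
  exists [set x] => //; exists g => // _ ->.
  rewrite /superlevel /mkset gE Normc.normcM normc_real.
  by rewrite ger0_norm ?invr_ge0 ?normc_ge0// mulVf.
Qed.

Lemma closed_open_bornology_of_ideal H : ideal H -> nonvanishing H ->
  closed_open_bornologies X (bornology_of_ideal H).
Proof.
move=> HI Hnv; have Bb := bornology_bornology_of_ideal HI Hnv.
split; split=> // A [h Hh Ah].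
  by exists (superlevel h 1); split=> //; [exists h|exact: closed_superlevel].
(* Any level in (0, 1) would do; this open set lies in the superlevel set of 2h at 1. *)
exists [set x | 2^-1 < normc (h x)]; split.
- by move=> x /Ah; rewrite /superlevel /mkset => h1; lra.
- have [g Hg gE] := ideal_scale 2 HI Hh.
  exists g => // x; rewrite /superlevel /mkset => hx.
  by rewrite gE Normc.normcM normc_real ger0_norm//; lra.
- apply: (@open_comp _ _ (fun x => normc (h x)) [set a | 2^-1 < a]).
    by move=> x _; exact: CB_normc_continuous.
  exact: open_gt.
Qed.

(** * The correspondences are mutually inverse and monotone *)

Lemma bornology_of_idealK H : ideal H -> closed H ->
  ideal_of_bornology (bornology_of_ideal H) = H.
Proof.
move=> HI Hcl; apply/seteqP; split=> [f Bf|h Hh e e0].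
  apply: Hcl; apply/closure_CBP => e e0.
  by have [h Hh fh] := Bf e e0; exact: ideal_approx HI Hh e0 fh.
(* The set where |h| >= e is the superlevel set of h / e at 1. *)
have [g Hg gE] := ideal_scale e^-1 HI Hh.
exists g => // x; rewrite /superlevel /mkset => eh.
rewrite gE Normc.normcM normc_real ger0_norm ?invr_ge0 ?(ltW e0)//.
by rewrite mulrC ler_pdivlMr// mul1r.
Qed.

Lemma ideal_of_bornology_subset B B' : normal_space X ->
  closed_open_bornologies X B -> closed_open_bornologies X B' ->
  ideal_of_bornology B `<=` ideal_of_bornology B' <-> B `<=` B'.
Proof.
move=> Xn BB [[[_ BS' _ _] _] _]; split=> [sub A BA|sub f Bf e e0].
  have [f Bf Af] := closed_open_bornology_level Xn BB BA.
  exact: BS' (sub f Bf 1 ltr01) Af.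
exact/sub/Bf.
Qed.

End ideals_and_bornologies.

Theorem theorem3p2p15 (R : realType) (X : topologicalType)
  (X_normal : normal_space X) (X_hausdorff : hausdorff_space X) :
  order_isomorphic_incl
    (closed_open_bornologies X) (nonvanishing_closed_ideals R X).
Proof.
exists (@ideal_of_bornology R X); split; last first.
  by move=> B B' BB BB'; exact: ideal_of_bornology_subset.
split.
- move=> B BB; have [[Bb _] _] := BB; split.
  + exact: ideal_ideal_of_bornology.
  + exact: ideal_of_bornology_nonvanishing.
  + exact: closed_ideal_of_bornology.
- move=> B B' /set_mem BB /set_mem BB' BB'E.
  (* Injectivity follows from order reflection applied in both directions. *)
  by apply/seteqP; split; apply/(ideal_of_bornology_subset R); rewrite ?BB'E.
- move=> H [HI Hnv Hcl]; exists (bornology_of_ideal H).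
    exact: closed_open_bornology_of_ideal.
  exact: bornology_of_idealK.
Qed.
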